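(* There is an absolute constant $c>0$ such that for every real $0<\alpha<1$ and every integer $t\ge 2$ there exists an infinite sequence $\mathcal{A}$ of positive integers with $d^{*}(\mathcal{A})>\alpha$ such that, writing $\mathcal{B}=\mathcal{A}\cdot\mathcal{A}=\{b_1<b_2<\cdots\}$, we have $b_{n+t}-b_n\ge c\,t^2\alpha^{-4}$ for every $n$.
   Context: For an infinite set $\mathcal{A}$ of positive integers, the upper Banach density is $d^{*}(\mathcal{A})=\limsup_{|I|\to\infty}\frac{|\mathcal{A}\cap I|}{|I|}$, where $I$ runs through all intervals of integers. The product set $\mathcal{A}\cdot\mathcal{A}$ is the set of all products $a_ia_j$ with $a_i,a_j\in\mathcal{A}$, and $b_1<b_2<\cdots$ denotes its elements in increasing order. *)

(* Defs.v *)
From HB Require Import structures.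
From mathcomp Require Import all_boot all_order all_algebra finmap.
From mathcomp Require Import all_classical all_reals all_analysis.

Set Implicit Arguments.
Unset Strict Implicit.
Unset Printing Implicit Defensive.

Import Order.TTheory GRing.Theory Num.Theory.

Local Open Scope classical_set_scope.
Local Open Scope ring_scope.

(* A pair [I = (a, L)] encodes the interval of integers {a, ..., a + L - 1},
   of length [I.2 = L]; its left endpoint may be negative. *)
Definition interval_trace (A : set nat) (I : int * nat) : set nat :=
  A `&` [set n : nat | I.1 <= n%:Z < I.1 + I.2%:Z].

(* The trace is always finite, so [fset_set] takes no junk value on it. For
   [L = 0] the quotient is 0 / 0 = 0, which does not affect the limsup. *)
Definition interval_density (R : realType) (A : set nat) (I : int * nat) : R :=
  (#|` fset_set (interval_trace A I)|%fset)%:R / I.2%:R.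

(* The limsup as |I| --> oo, uniformly in the position of I: this is [limf_esup]
   along the filter generated by the sets {I : |I| >= M}, spelled out because
   [int * nat] is not a [filteredType]. *)
Definition upper_banach_density (R : realType) (A : set nat) : \bar R :=
  ereal_inf (range (fun M : nat =>
    ereal_sup [set (interval_density R A I)%:E
                | I in [set I : int * nat | (M <= I.2)%N]])).

Definition product_set (A : set nat) : set nat :=
  [set (x * y)%N | x in A & y in A].

(* [b] lists the elements of [B] in increasing order, starting at index 0. *)
Definition increasing_enumeration (B : set nat) (b : nat -> nat) : Prop :=
  {homo b : m n / (m < n)%N} /\ range b = B.

(* Main.v *)
(* Let D be a Sidon set modulo M of density just above alpha, so that M is at
   least a constant times alpha^-2 (Bose's construction with q = 2^k elements
   modulo q^2 - 1). Let A consist of the integers with residue in D lying in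
   longer and longer blocks which are extremely far apart. Then two distinct
   products in A.A that are close to each other come from pairs of factors with
   the same sum s. For such pairs the smaller factor p lies in one of only two
   residue classes modulo M, so among any three of the smaller factors two differ
   by at least M; and the product p (s - p), with 2p <= s, grows by at least the
   square of the growth of p. Hence t steps in A.A cover at least
   (M * floor(t/2))^2, which is of order t^2 alpha^-4. *)
Require Import Defs.
From HB Require Import structures.
From mathcomp Require Import all_boot all_order all_algebra finmap.
From mathcomp Require Import cyclic finfield.
From mathcomp Require Import all_classical all_reals all_analysis.
From mathcomp Require Import zify ring lra.

Set Implicit Arguments.
Unset Strict Implicit.
Unset Printing Implicit Defensive.

Import Order.TTheory GRing.Theory Num.Theory.

Local Open Scope classical_set_scope.
Local Open Scope ring_scope.

(** * Sidon sets modulo [M] and Bose's construction *)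

Definition sidon_mod (M : nat) (D : seq nat) : Prop :=
  {in D & &, forall a b c, {in D, forall d, (a + b = c + d %[mod M])%N ->
    (a = c /\ b = d) \/ (a = d /\ b = c)}}.

(** The nonzero elements are [#|F|.-1] distinct roots of unity of that order, enough to force a
    primitive one among them. *)
Lemma finField_prim_root (F : finFieldType) :
  exists g : F, (#|F|.-1).-primitive_root g.
Proof.
have F1 : (1 < #|F|)%N by exact: finNzRing_gt1.
have : has (#|F|.-1).-primitive_root [seq x <- enum F | x != 0].
  apply: has_prim_root.
  - by rewrite -ltnS prednK // ltnW.
  - apply/allP => x; rewrite mem_filter => /andP[x0 _]; apply/unity_rootP.
    apply: (mulfI x0); rewrite mulr1 -exprS prednK ?expf_card //.
    exact: ltnW.
  - by rewrite filter_uniq ?enum_uniq.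
  - rewrite size_filter cardE -(count_predC (pred1 0) (enum F)).
    by rewrite (count_uniq_mem 0 (enum_uniq _)) mem_enum.
by case/hasP => g _ prim_g; exists g.
Qed.

(* Bose: D is the set of discrete logarithms of the elements g + c, where g is a
   primitive root of the field with q^2 elements, q = p^k, and c runs through its
   subfield with q elements, defined by K below. *)
Lemma bose_sidon (p k : nat) : prime p -> (0 < k)%N -> exists D : seq nat,
  [/\ uniq D, all (fun d => d < (p ^ k) ^ 2 - 1)%N D, (p ^ k <= size D)%N &
      sidon_mod ((p ^ k) ^ 2 - 1) D].
Proof.
move=> p_pr k_gt0; set q := (p ^ k)%N; set n := (q ^ 2 - 1)%N.
have q_gt1 : (1 < q)%N by rewrite -(exp1n k) ltn_exp2r // prime_gt1.
have k2_gt0 : (0 < k * 2)%N by rewrite muln_gt0 k_gt0.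
have [F pcharF cardF] := pPrimePowerField p_pr k2_gt0.
have [g] := finField_prim_root F.
rewrite cardF expnM -/q -subn1 -/n => prim_g.
have n_gt0 : (0 < n)%N by rewrite /n; nia.
have q2E : (q ^ 2 = n.+1)%N by rewrite /n; nia.
pose K (x : F) := x ^+ q == x.
have q_pnat : [pchar F].-nat q.
  by rewrite /q pnatX pnatE // pcharF.
have KD x y : K x -> K y -> K (x + y).
  by rewrite /K exprDn_pchar // => /eqP-> /eqP->.
have KN x : K x -> K (- x).
  (* Expanding the [q]-th power of [- x + x] avoids a case distinction on the parity of [q]. *)
  rewrite /K => /eqP Kx; rewrite -subr_eq0 opprK -{2}Kx.
  by rewrite -exprDn_pchar // addNr expr0n; case: (q) q_gt1.
have KM x y : K x -> K y -> K (x * y).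
  by rewrite /K exprMn => /eqP-> /eqP->.
have KV x : K x -> K x^-1 by rewrite /K exprVn => /eqP->.
have gn : g ^+ n = 1 by exact: prim_expr_order.
have g_neq0 : g != 0.
  by apply: contra_eq_neq gn => ->; rewrite expr0n gtn_eqF // eq_sym oner_neq0.
(* The exponents [1] and [q] are distinct and below the order [n] of [g]. *)
have KNg : ~~ K g.
  rewrite /K -{2}[g]expr1 (eq_prim_root_expr prim_g) !modn_small //;
    by rewrite /n; nia.
pose D := [seq a <- iota 0 n | K (g ^+ a - g)].
have D_lt a : a \in D -> (a < n)%N by rewrite mem_filter mem_iota => /andP[].
have D_inj a b : a \in D -> b \in D -> g ^+ a = g ^+ b -> a = b.
  move=> /D_lt an /D_lt bn /eqP.
  by rewrite (eq_prim_root_expr prim_g) !modn_small // => /eqP.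
exists D; split.
- by rewrite filter_uniq ?iota_uniq.
- by apply/allP => a /D_lt.
(* [cs] lists [q] elements [c] of the subfield. Each [g + c] is nonzero because [g] is outside the
   subfield, so it has a discrete logarithm, which lies in [D]. *)
- pose cs : seq F := 0 :: [seq g ^+ (q.+1 * i) | i <- iota 0 q.-1].
  have cs_size : size cs = q by rewrite /= size_map size_iota prednK // ltnW.
  have mulq1 i : (i < q.-1)%N -> (q.+1 * i < n)%N by rewrite /n; nia.
  have cs_uniq : uniq cs.
    rewrite cons_uniq; apply/andP; split.
      apply/mapP => -[i _ /esym/eqP]; apply/negP.
      by rewrite expf_neq0.
    rewrite map_inj_in_uniq ?iota_uniq // => i j.
    rewrite !mem_iota !add0n /= => iq jq /eqP.
    rewrite (eq_prim_root_expr prim_g) !modn_small ?mulq1 //.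
    by rewrite eqn_pmul2l // => /eqP.
  rewrite -cs_size -(size_map (fun a => g ^+ a - g) D).
  apply: uniq_leq_size cs_uniq _ => c c_cs.
  have Kc : K c.
    move: c_cs; rewrite inE => /predU1P[->|/mapP[i _ ->]].
      by rewrite /K expr0n; case: (q) q_gt1.
    rewrite /K -exprM (_ : q.+1 * i * q = q.+1 * i + i * n)%N; last first.
      by rewrite /n; nia.
    by rewrite exprD mulnC exprM (mulnC i) exprM gn expr1n mulr1 -exprM mulnC.
  have gc_neq0 : g + c != 0.
    by apply: contraNneq KNg => /eqP; rewrite addr_eq0 => /eqP->; apply: KN.
  have gcn : (g + c) ^+ n = 1.
    apply: (mulfI gc_neq0); rewrite mulr1 -exprS -q2E.
    by rewrite -[RHS]expf_card cardF expnM.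
  have [i gci] := prim_rootP prim_g gcn.
  apply/mapP; exists (i : nat).
    by rewrite mem_filter mem_iota /= ltn_ord -gci addrC addKr Kc.
  by rewrite -gci addrC addKr.
- move=> a b c aD bD cD d dD /eqP; rewrite -(eq_prim_root_expr prim_g) !exprD.
  have K_of x : x \in D -> K (g ^+ x - g) by rewrite mem_filter => /andP[].
  have := (K_of _ aD, K_of _ bD, K_of _ cD, K_of _ dD).
  set u := g ^+ a - g; set v := g ^+ b - g.
  set w := g ^+ c - g; set z := g ^+ d - g => -[[[Ku Kv] Kw] Kz].
  have [ga gb gc gd] : [/\ g ^+ a = g + u, g ^+ b = g + v,
      g ^+ c = g + w & g ^+ d = g + z].
    by split; rewrite addrC subrK.
  rewrite ga gb gc gd => /eqP E.
  have Es : g * (u + v - w - z) = w * z - u * v.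
    apply/eqP; rewrite -subr_eq0; apply/eqP.
    transitivity ((g + u) * (g + v) - (g + w) * (g + z)); first by ring.
    by rewrite E subrr.
  (* Otherwise [g] would be a quotient of subfield elements. Hence the pairs [u, v] and [w, z] have
     the same sum and the same product. *)
  have s0 : u + v - w - z = 0.
    apply/eqP; apply: contraNT KNg => s_neq0.
    rewrite -(mulfK s_neq0 g) Es; apply/KM; last apply/KV.
      by apply/KD; [|apply/KN]; apply/KM.
    by do 2!(apply/KD; last exact: KN); apply/KD.
  have uv : w * z - u * v = 0 by rewrite -Es s0 mulr0.
  have : (u - w) * (u - z) == 0.
    apply/eqP; transitivity (u * (u + v - w - z) + (w * z - u * v)); first ring.
    by rewrite s0 uv mulr0 addr0.
  have tail x y : u = x -> u + v - x - y = 0 -> v = y.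
    by move=> ->; rewrite [x + v]addrC addrK => /subr0_eq.
  rewrite mulf_eq0 !subr_eq0 => /orP[] /eqP ux; [left|right].
    by split; apply: D_inj; rewrite ?ga ?gb ?gc ?gd ?ux // (tail w z).
  split; apply: D_inj; rewrite ?ga ?gb ?gc ?gd ?ux // (tail z w) //.
  by rewrite addrAC.
Qed.

(** * Gaps between products with a common factor sum *)

Local Open Scope nat_scope.

Lemma modn_eq_ltn_leq (M x y : nat) : x = y %[mod M] -> x < y -> x + M <= y.
Proof.
move=> /esym/eqP xy lt_xy; rewrite eqn_mod_dvd ?(ltnW lt_xy) // in xy.
by rewrite -leq_subRL ?(ltnW lt_xy) // dvdn_leq // subn_gt0.
Qed.

(** By the Sidon property [p i] is congruent to [p j] or to [r j]. So two of any three consecutive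
    values of [p] agree modulo [M], and every two steps gain at least [M]. *)
Lemma sidon_same_sum_spread (M : nat) (D : seq nat) (s t : nat)
    (p r : nat -> nat) :
  sidon_mod M D ->
  (forall j, j <= t -> [/\ p j %% M \in D, r j %% M \in D & p j + r j = s]) ->
  (forall j, j < t -> p j < p j.+1) ->
  p 0 + M * t./2 <= p t.
Proof.
move=> sidonD prD p_incr.
have eq_or_swap i j : i <= t -> j <= t ->
    p i = p j %[mod M] \/ p i = r j %[mod M].
  move=> /prD[piD riD sum_i] /prD[pjD rjD sum_j].
  have [|[]|[]] := sidonD _ _ _ piD riD pjD _ rjD; [|by left|by right].
  by rewrite !modnDm sum_i sum_j.
have p_incr2 j : j.+2 <= t -> p j + M <= p j.+2.
  move=> j2t; have j1t := ltnW j2t; have jt := ltnW j1t.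
  have lt1 := p_incr _ j1t; have lt2 := p_incr _ j2t.
  have [e1|e1] := eq_or_swap j j.+1 jt j1t.
    by rewrite (leq_trans (modn_eq_ltn_leq e1 lt1)) // ltnW.
  have [e2|e2] := eq_or_swap j j.+2 jt j2t.
    by rewrite (modn_eq_ltn_leq e2) // (ltn_trans lt1).
  (* Here [r j.+1] and [r j.+2] are both congruent to [p j], so their complements in [s] agree
     modulo [M]. *)
  suff e : p j.+1 = p j.+2 %[mod M].
    by apply: leq_trans (modn_eq_ltn_leq e lt2); rewrite leq_add2r ltnW.
  have [_ _ s1] := prD _ j1t; have [_ _ s2] := prD _ j2t.
  apply/eqP; rewrite -(eqn_modDr (p j)) -{1}(modnDmr (p j.+1)) e1 modnDmr s1.
  by rewrite -(modnDmr (p j.+2)) e2 modnDmr s2.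
have even_step m : m.*2 <= t -> p 0 + M * m <= p m.*2.
  elim: m => [|m IHm]; first by rewrite muln0 addn0.
  rewrite doubleS mulnS addnCA addnC => m2t.
  apply: leq_trans (p_incr2 _ m2t); rewrite leq_add2r IHm //.
  by rewrite (leq_trans _ m2t) // -addn2 leq_addr.
have le_half : t./2.*2 <= t by rewrite -[leqRHS]odd_double_half leq_addl.
apply: leq_trans (even_step _ le_half) _.
have := odd_double_half t; case: (odd t) => e; last by rewrite -[in leqRHS]e.
by rewrite -[in leqRHS]e ltnW // p_incr // -[ltnRHS]e.
Qed.

(* Products with a common factor sum s are s^2/4 minus the square of half the
   factor difference, whence the square in the separation. *)
Lemma sidon_product_gap (M t : nat) (D : seq nat) (A : set nat)
    (b : nat -> nat) :
  sidon_mod M D ->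
  (forall a, A a -> a %% M \in D) ->
  (forall a1 a2 a3 a4, A a1 -> A a2 -> A a3 -> A a4 ->
    a1 * a2 < a3 * a4 < a1 * a2 + (M * t./2) ^ 2 -> a1 + a2 = a3 + a4) ->
  increasing_enumeration (product_set A) b ->
  forall n, b n + (M * t./2) ^ 2 <= b (n + t).
Proof.
move=> sidonD AD sepA [b_incr b_range] n; rewrite leqNgt; apply/negP => close.
have b_prod j : exists pr : nat * nat,
    [/\ A pr.1, A pr.2, pr.1 <= pr.2 & pr.1 * pr.2 = b (n + j)].
  have : product_set A (b (n + j)) by rewrite -b_range; exists (n + j).
  move=> [x Ax [y Ay xy]]; have [le_xy|lt_yx] := leqP x y.
    by exists (x, y).
  by exists (y, x); split; rewrite //= 1?mulnC // ltnW.
have {b_prod} [f fP] := choice b_prod.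
pose p j := (f j).1; pose r j := (f j).2.
have b_lt i j : i < j -> b (n + i) < b (n + j).
  by move=> ij; apply: b_incr; rewrite ltn_add2l.
have sum j : j <= t -> p j + r j = p 0 + r 0.
  case: j => [//|j] jt; have [A1 A2 _ e1] := fP 0; have [A3 A4 _ e2] := fP j.+1.
  apply/esym/sepA => //; rewrite e1 e2 b_lt //= addn0.
  apply: leq_ltn_trans close; move: jt; rewrite leq_eqVlt => /predU1P[->//|].
  by move=> /b_lt /ltnW.
(* For a fixed sum [s], the product [p * (s - p)] increases with [p] as long as [2 * p <= s]. *)
have p_incr j : j < t -> p j < p j.+1.
  move=> jt; have := sum _ jt; have := sum _ (ltnW jt).
  have [_ _ ] := fP j; have [_ _] := fP j.+1; have := b_lt _ _ (ltnSn j).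
  rewrite -/(p _) -/(r _) -/(p _) -/(r _); nia.
have spread : p 0 + M * t./2 <= p t.
  apply: sidon_same_sum_spread p_incr; [exact: sidonD | move=> j jt].
  have [A1 A2 _ _] := fP j.
  by split; [exact: AD A1 | exact: AD A2 | exact: sum].
have [_ _ le_t bt] := fP t; have [_ _ _ b0] := fP 0.
rewrite addn0 in b0; move: close; rewrite -bt -b0 ltnNge => /negP; apply.
move: (sum t (leqnn t)) le_t spread; rewrite /p /r.
move: (f t) (f 0) (M * t./2) => [pt rt] [p0 r0] m /= {}sum le_t spread.
(* In terms of [d] and [e] the two products differ by [d * (d + e)], which is at least [m ^ 2]. *)
have [d ptE] : exists d, pt = p0 + d by exists (pt - p0); lia.
have [e rtE] : exists e, rt = pt + e by exists (rt - pt); lia.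
have r0E : r0 = p0 + d + d + e by lia.
have le_md : m <= d by lia.
rewrite r0E rtE ptE (_ : (p0 + d) * _ = p0 * (p0 + d + d + e) + d * (d + e)).
  by rewrite leq_add2l leq_mul // (leq_trans le_md) ?leq_addr.
by ring.
Qed.

(** * Sparse blocks: close products have equal factor sums *)

(** [x k] will start a block of length [M * k.+1]. Squares appear because a start must dominate
    products of two elements of earlier blocks, with margin [G]. *)
Lemma sparse_blocks (M G : nat) : 0 < M -> exists x : nat -> nat,
  [/\ forall k, M %| x k,
      forall k, (M * k.+1 + G + 1) ^ 2 <= x k &
      forall k l, k < l -> (x k + M * k.+1 + M * l.+1 + G + 1) ^ 2 <= x l].
Proof.
move=> M_gt0; pose next k y := M * (y + M * k.+1 + M * k.+2 + G + 1) ^ 2.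
pose x := nat_rect (fun=> nat) (M * (M + G + 1) ^ 2) next.
have x_next k : (x k + M * k.+1 + M * k.+2 + G + 1) ^ 2 <= x k.+1.
  by rewrite leq_pmull.
have x_incr k l : k <= l -> x k <= x l.
  elim: l => [|l IHl]; first by rewrite leqn0 => /eqP->.
  rewrite leq_eqVlt => /predU1P[->//|/IHl /leq_trans]; apply.
  by apply: leq_trans (x_next l); nia.
exists x; split=> [[|k]|[|k]|k [//|l] kl].
- exact: dvdn_mulr.
- exact: dvdn_mulr.
- by rewrite muln1 leq_pmull.
- by apply: leq_trans (x_next k); rewrite leq_exp2r //; lia.
- apply: leq_trans (x_next l); rewrite leq_exp2r //.
  by rewrite !leq_add // ?x_incr // leq_mul2l kl orbT.
Qed.

(** For a block starting at [y], [e] is the end of an earlier block and [K] the length of the block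
    at [y]; alternatively [K = 0] and [e] is that length. *)
Lemma sqr_sparse_bounds (e K G y : nat) : (e + K + G + 1) ^ 2 <= y ->
  [/\ e * e + G <= y, 2 * e + G <= y, e * K + G <= y & 0 < y].
Proof.
have -> : (e + K + G + 1) ^ 2 = e * e + K * K + G * G + 1 + 2 * (e * K)
  + 2 * (e * G) + 2 * (K * G) + 2 * e + 2 * K + 2 * G by ring.
by move=> h; split; lia.
Qed.

(** Products less than [G] apart must have their larger factors in a common block, and then their
    smaller factors too. If these two blocks coincide, the factor sum governs the size of the
    product; if they differ, distinct products are at least [G] apart. *)
Lemma sparse_blocks_sum_eq (x L : nat -> nat) (G : nat) :
  (forall k, (L k + G + 1) ^ 2 <= x k) ->
  (forall k l, k < l -> (x k + L k + L l + G + 1) ^ 2 <= x l) ->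
  forall k1 k2 k3 k4 a1 a2 a3 a4, k1 <= k2 -> k3 <= k4 ->
    x k1 <= a1 < x k1 + L k1 -> x k2 <= a2 < x k2 + L k2 ->
    x k3 <= a3 < x k3 + L k3 -> x k4 <= a4 < x k4 + L k4 ->
    a1 * a2 < a3 * a4 + G -> a3 * a4 < a1 * a2 + G -> a1 * a2 != a3 * a4 ->
  a1 + a2 = a3 + a4.
Proof.
move=> x_ge x_sparse.
have x_gt k l : k <= l -> x k + L k <= x l + L l.
  rewrite leq_eqVlt => /predU1P[->//|/x_sparse /sqr_sparse_bounds[_ ? _ _]]; lia.
have xL k : [/\ L k * L k + G <= x k, 2 * L k + G <= x k & 0 < x k].
  by have := x_ge k; rewrite -[L k]addn0 => /sqr_sparse_bounds[]; rewrite !addn0.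
move=> k1 k2 k3 k4; wlog le24 : k1 k2 k3 k4 / k2 <= k4.
  move=> wlog24 a1 a2 a3 a4 le12 le34 B1 B2 B3 B4 lt1 lt2 ne.
  have [le24|/ltnW le42] := leqP k2 k4.
    exact: (wlog24 k1 k2 k3 k4).
  by apply/esym/(wlog24 k3 k4 k1 k2) => //; rewrite eq_sym.
move=> a1 a2 a3 a4 le12 le34 B1 B2 B3 B4 lt1 lt2 ne.
move: le24; rewrite leq_eqVlt => /predU1P[eq24|lt24]; last first.
  exfalso; have [x24 _ _ _] := sqr_sparse_bounds (x_sparse _ _ lt24).
  have x12 := x_gt _ _ le12; have [_ _ x3] := xL k3.
  have : a1 * a2 <= (x k2 + L k2) * (x k2 + L k2) by apply: leq_mul; lia.
  have : a4 <= a3 * a4 by rewrite leq_pmull //; lia.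
  lia.
subst k4; move: k2 le12 le34 B2 B4 => l le1 le3 B2 B4.
wlog le13 : k1 k3 a1 a2 a3 a4 le1 le3 B1 B2 B3 B4 lt1 lt2 ne / k1 <= k3.
  move=> wlog13; have [le13|/ltnW le31] := leqP k1 k3.
    exact: (wlog13 k1 k3).
  by apply/esym/(wlog13 k3 k1) => //; rewrite eq_sym.
move: le13; rewrite leq_eqVlt => /predU1P[eq13|lt13]; last first.
  exfalso; have [_ x13 _ _] := sqr_sparse_bounds (x_sparse _ _ lt13).
  have [_ xl xl_gt0] := xL l.
  have : a1 * a2 <= (x k1 + L k1) * (x l + x l) by apply: leq_mul; lia.
  have : (2 * (x k1 + L k1) + G) * x l <= a3 * a4 by apply: leq_mul; lia.
  have : G <= G * x l by rewrite leq_pmulr.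
  lia.
subst k3.
move: le1; rewrite leq_eqVlt => /predU1P[eq1|lt1l].
  subst k1; have [+ _ _] := xL l.
  wlog lt_s : a1 a2 a3 a4 B1 B2 B3 B4 lt1 lt2 ne / a1 + a2 < a3 + a4.
    move=> wlogs xl; case: (ltngtP (a1 + a2) (a3 + a4)) => // lt_s.
      exact: wlogs.
    by apply/esym/wlogs => //; rewrite eq_sym.
  move=> xl; exfalso; move: B1 B2 B3 B4.
  move: (x l) (L l) xl => y K yK.
  move=> /andP[B1 B1'] /andP[B2 B2'] /andP[B3 B3'] /andP[B4 B4'].
  have [i1 E1] : exists i, a1 = y + i by exists (a1 - y); lia.
  have [i2 E2] : exists i, a2 = y + i by exists (a2 - y); lia.
  have [i3 E3] : exists i, a3 = y + i by exists (a3 - y); lia.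
  have [i4 E4] : exists i, a4 = y + i by exists (a4 - y); lia.
  have i12 : i1 * i2 <= K * K by apply: leq_mul; lia.
  (* A larger sum gains at least [y], while the offset products cost at most [K * K]; the net gain
     is at least [G]. *)
  have : y * (i1 + i2).+1 <= y * (i3 + i4) by rewrite leq_mul //; lia.
  subst; lia.
(* Two different blocks: a larger first factor gains at least [x l] and loses at most
   [(x k1 + L k1) * L l]. With equal first factors the products differ by a nonzero multiple of
   [a1], and [G <= a1]. *)
exfalso; have [_ _ + _] := sqr_sparse_bounds (x_sparse _ _ lt1l).
wlog lt_a : a1 a2 a3 a4 B1 B2 B3 B4 lt1 lt2 ne / a1 < a3.
  move=> wloga; case: (ltngtP a1 a3) => [||eq_a] lt_a.
  - exact: (wloga a1 a2 a3 a4).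
  - by apply: (wloga a3 a4 a1 a2) => //; rewrite eq_sym.
  - subst a3; have [_ G_le _] := xL k1.
    have lt_G i j : a1 * i < a1 * j -> a1 * i + G <= a1 * j.
      rewrite ltn_mul2l => /andP[_ ij].
      have : a1 * i.+1 <= a1 * j by rewrite leq_mul2l ij orbT.
      lia.
    move: ne; rewrite neq_ltn => /orP[] /lt_G; lia.
move=> xl.
have : a1.+1 * x l <= a3 * a4 by apply: leq_mul; lia.
have : a1 * a2 <= a1 * (x l + L l) by apply: leq_mul; lia.
have : a1 * L l <= (x k1 + L k1) * L l by apply: leq_mul; lia.
lia.
Qed.

(** * Increasing enumeration of an infinite set *)

Lemma infinite_set_nat_unbounded (B : set nat) : infinite_set B ->
  forall m, exists n, B n /\ m <= n.
Proof.
move=> Binf m; apply: contrapT => noB; apply: Binf.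
apply: (@sub_finite_set _ _ `I_m); last exact: finite_II.
by move=> n Bn /=; rewrite ltnNge; apply/negP => mn; apply: noB; exists n.
Qed.

Lemma increasing_enumeration_exists (B : set nat) : infinite_set B ->
  exists b, increasing_enumeration B b.
Proof.
move=> Binf.
have next m : exists n, [/\ B n, m <= n & forall k, B k -> m <= k -> n <= k].
  have ex : exists n, `[< B n >] && (m <= n).
    have [n [Bn mn]] := infinite_set_nat_unbounded Binf m.
    by exists n; rewrite mn asboolT.
  case: (ex_minnP ex) => n /andP[/asboolP Bn mn] n_min.
  exists n; split=> // k Bk mk.
  by apply: n_min; rewrite mk asboolT.
have {next} [f fP] := choice next.
pose b := nat_rect (fun=> nat) (f 0) (fun _ y => f y.+1).
have b_step n : b n < b n.+1 by have [] := fP (b n).+1.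
have b_incr : {homo b : m n / m < n}.
  exact: (homo_ltn ltn_trans).
exists b; split=> //; apply/seteqP; split.
  by move=> _ [[|n] _ <-] /=; [have [] := fP 0 | have [] := fP (b n).+1].
move=> k Bk.
(* Every [k] in [B] is thus overtaken, and the first [b n] with [k <= b n] equals [k] by the
   minimality in the choice of [f]. *)
have b_ge n : n <= b n by elim: n => // n IHn; apply: leq_ltn_trans (b_step n).
have ex : exists n, k <= b n by exists k.
case: (ex_minnP ex) => n kn n_min; exists n => //; apply/eqP.
rewrite eqn_leq kn andbT; case: n kn n_min => [|n] kn n_min.
  by have [_ _] := fP 0; apply.
have [_ _] := fP (b n).+1; apply=> //.
by rewrite ltnNge; apply/negP => /n_min; rewrite ltnn.
Qed.

(** * The block set, its density, and the choice of [D] *)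

(** The block lengths grow because upper Banach density only sees long intervals. *)
Definition block_set (x : nat -> nat) (M : nat) (D : seq nat) : set nat :=
  [set a | a %% M \in D /\ exists k, x k <= a < x k + M * k.+1].

Local Close Scope nat_scope.

(** The [N]-th block is an interval of length at least [N] made of [N.+1] full periods modulo [M],
    each containing [size D] elements of the set. *)
Lemma block_set_density (R : realType) (x : nat -> nat) (M : nat)
    (D : seq nat) :
  (0 < M)%N -> (forall k, (M %| x k)%N) -> uniq D -> all (fun d => d < M)%N D ->
  (((size D)%:R / M%:R : R)%:E <=
    upper_banach_density R (block_set x M D))%E.
Proof.
move=> M_gt0 Mx D_uniq /allP D_lt; apply: le_ereal_inf_tmp => _ [N _ <-].
apply: (@le_trans _ _
  (interval_density R (block_set x M D) ((x N)%:Z, M * N.+1)%N)%:E); last first.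
  apply: ereal_sup_ubound; exists ((x N)%:Z, M * N.+1)%N => //=.
  by rewrite (leq_trans (leqnSn N)) // leq_pmull.
rewrite lee_fin /interval_density /= natrM invfM mulrA mulrAC.
rewrite ler_pM2r ?invr_gt0 ?ltr0n // ler_pdivlMr ?ltr0n // -natrM ler_nat.
set tr := interval_trace _ _.
have tr_fin : finite_set tr.
  apply: (@sub_finite_set _ _ `I_(x N + M * N.+1)%N); last exact: finite_II.
  by move=> n [_ /=]; rewrite -PoszD ltz_nat => /andP[].
pose s := [seq (x N + (M * i + d))%N | i <- iota 0 N.+1, d <- D].
have <- : size s = (size D * N.+1)%N by rewrite size_allpairs size_iota mulnC.
apply: uniq_leq_size.
  apply: allpairs_uniq; rewrite ?iota_uniq // => u v.
  move=> /allpairsP[[i d] [_ dD ->]] /allpairsP[[j e] [_ eD ->]] /addnI E.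
  rewrite /= in dD eD E.
  have dM := D_lt _ dD; have eM := D_lt _ eD.
  have de : d = e.
    by move: (congr1 (modn^~ M) E); rewrite /= !(mulnC M) !modnMDl !modn_small.
  by move: E; rewrite de => /addIn /eqP; rewrite eqn_pmul2l // => /eqP ->.
move=> _ /allpairsP[[i d] [/[1!mem_iota] /= iN dD ->]] /=; have dM := D_lt _ dD.
rewrite in_fset_set // inE; rewrite add0n in iN.
have lt : (M * i + d < M * N.+1)%N by nia.
split; last by rewrite /= -PoszD lez_nat ltz_nat leq_addr ltn_add2l.
split; last by exists N; rewrite leq_addr ltn_add2l.
rewrite addnA addnC -modnDmr (eqP (_ : (M %| x N + M * i)%N)) ?addn0 ?modn_small //.
by rewrite dvdn_addr // dvdn_mulr.
Qed.

(** For [alpha] at most one half, take [q = 2 ^ k] with [1 / (2 q) < alpha <= 1 / q]. Then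
    [q / (q ^ 2 - 1)] exceeds [alpha], and [alpha ^- 2 < 4 q ^ 2 <= 8 (q ^ 2 - 1)]. *)
Lemma dense_sidon (R : realType) (alpha : R) : 0 < alpha < 1 ->
  exists (M : nat) (D : seq nat),
    [/\ (0 < M)%N, uniq D, all (fun d => d < M)%N D, sidon_mod M D &
        alpha < (size D)%:R / M%:R /\ alpha ^- 2 <= 8 * M%:R].
Proof.
move=> /andP[alpha_gt0 alpha_lt1].
(* Above one half the trivial modulus [1] gives density one, and [alpha ^- 2 < 4]. *)
have [small|large] := leP alpha (1 / 2); last first.
  exists 1%N, [:: 0%N]; split=> //.
    by move=> a b c; rewrite !inE => /eqP-> /eqP-> /eqP-> d; rewrite inE => /eqP->; left.
  split; first by rewrite divr1.
  rewrite mulr1 -[_ ^- 2]mul1r ler_pdivrMr ?exprn_gt0 //; nra.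
have ex : exists k, 1 < (2 ^ k.+1)%:R * alpha.
  exists (Num.truncn alpha^-1); rewrite -ltr_pdivrMr // mul1r.
  apply: (lt_trans (truncnS_gt _)); rewrite ltr_nat; exact: ltn_expl.
case: (ex_minnP ex) => k k_lo k_min.
have k_gt0 : (0 < k)%N.
  by rewrite lt0n; apply: contraTneq k_lo => ->; rewrite -leNgt expn1; lra.
have k_hi : (2 ^ k)%:R * alpha <= 1.
  rewrite leNgt; apply/negP; move: k_gt0 k_min; case: (k) => // j _ /(_ j).
  by rewrite ltnn => h /h.
have [D [D_uniq D_lt D_size D_sidon]] := bose_sidon (isT : prime 2) k_gt0.
move: k_lo k_hi; set q := (2 ^ k)%N in D_lt D_size D_sidon *.
have q_ge2 : (2 <= q)%N by rewrite -[2%N]expn1 leq_exp2l.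
have M_gt0 : (0 < q ^ 2 - 1)%N by nia.
rewrite expnS -/q natrM => k_lo k_hi.
have q2 : 2 <= q%:R :> R by rewrite ler_nat.
exists (q ^ 2 - 1)%N, D; split=> //.
have ME : (q ^ 2 - 1)%:R = q%:R ^+ 2 - 1 :> R by rewrite natrB ?natrX //; nia.
have MR : 0 < (q ^ 2 - 1)%:R :> R by rewrite ltr0n.
split.
  rewrite ltr_pdivlMr //; apply: lt_le_trans (_ : q%:R <= _); last by rewrite ler_nat.
  rewrite ME; nra.
rewrite ME -[_ ^- 2]mul1r ler_pdivrMr ?exprn_gt0 //.
have : 1 <= (2 * q%:R * alpha) ^+ 2 by rewrite exprn_ege1 // ltW.
nra.
Qed.

(** * Assembly of the lower bound for the gaps *)

Unset Implicit Arguments.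

Theorem theorem4 (R : realType) :
  exists c : R, 0 < c /\
    forall (alpha : R) (t : nat), 0 < alpha < 1 -> (2 <= t)%N ->
      exists (A : set nat) (b : nat -> nat),
        [/\ infinite_set A,
            (forall a : nat, A a -> (0 < a)%N),
            (alpha%:E < upper_banach_density R A)%E,
            increasing_enumeration (product_set A) b &
            forall n : nat,
              c * t%:R ^+ 2 * alpha ^- 4 <= (b (n + t)%N)%:R - (b n)%:R].
Proof.
(* [24 = 3 * 8], from [t <= 3 * t./2] for [t >= 2] (sharp at [t = 3]) and [alpha ^- 2 <= 8 * M]. *)
exists (24 ^- 2); split=> [|alpha t alpha01 t_ge2].
  by rewrite invr_gt0 exprn_gt0 // ltr0n.
have [M [D [M_gt0 D_uniq D_lt D_sidon [dens M_ge]]]] := dense_sidon alpha01.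
have alpha_gt0 : 0 < alpha by case/andP: alpha01.
pose G := ((M * t./2) ^ 2)%N.
have [x [Mx x_ge x_sparse]] := sparse_blocks G M_gt0.
pose A := block_set x M D.
have x_gt0 k : (0 < x k)%N by apply: leq_trans (x_ge k); rewrite expn_gt0 addn1.
have x_incr k l : (k < l)%N -> (x k < x l)%N.
  by move=> /x_sparse /sqr_sparse_bounds[_ + _ _]; have := x_gt0 k; lia.
have A_gt0 a : A a -> (0 < a)%N.
  by move=> [_ [k /andP[+ _]]]; apply: leq_trans.
have [d dD] : exists d, d \in D.
  case: (D) dens => [|d D' _]; last by exists d; rewrite mem_head.
  by rewrite mul0r ltNge ltW.
have Ax k : A (x k + d)%N.
  have dM := allP D_lt _ dD; split; last first.
    by exists k; rewrite leq_addr ltn_add2l (leq_trans dM) // leq_pmulr.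
  by rewrite -modnDml (eqP (Mx k)) modn_small.
have A_inf : infinite_set A.
  have x_inj : injective (fun k => x k + d)%N.
    by move=> k l /addIn; case: (ltngtP k l) => // /x_incr; lia.
  move=> A_fin; apply: infinite_nat.
  rewrite (_ : setT = (fun k => x k + d)%N @^-1` A).
    by apply: finite_preimage => // k l _ _; exact: x_inj.
  by apply/esym/seteqP; split=> // k _; exact: Ax.
have B_inf : infinite_set (product_set A).
  move=> B_fin; apply: A_inf; set a0 := (x 0 + d)%N.
  apply: (@sub_finite_set _ _ ((muln a0) @^-1` product_set A)).
    by move=> a Aa; exists a0; [exact: Ax | exists a].
  apply: finite_preimage => // k l _ _ /eqP.
  by rewrite eqn_pmul2l ?(A_gt0 _ (Ax 0%N)) // => /eqP.
have [b bP] := increasing_enumeration_exists B_inf.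
exists A, b; split=> // [|n].
  exact: lt_le_trans (block_set_density R M_gt0 Mx D_uniq D_lt).
have gap : (b n + G <= b (n + t))%N.
  apply: sidon_product_gap D_sidon _ _ bP n => [a [] //|].
  have key a1 a2 a3 a4 : A a1 -> A a2 -> A a3 -> A a4 ->
      (a1 * a2 < a3 * a4 < a1 * a2 + (M * t./2) ^ 2)%N -> (a1 + a2 = a3 + a4)%N.
    move=> [_ [k1 B1]] [_ [k2 B2]] [_ [k3 B3]] [_ [k4 B4]] /andP[lo hi].
    have main := sparse_blocks_sum_eq x_ge x_sparse.
    have lo' : (a1 * a2 < a3 * a4 + G)%N by rewrite (leq_trans lo) // leq_addr.
    have ne : (a1 * a2 != a3 * a4)%N by rewrite ltn_eqF.
    have [le12|/ltnW le21] := leqP k1 k2; have [le34|/ltnW le43] := leqP k3 k4.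
    - exact: (main k1 k2 k3 k4).
    - by rewrite (addnC a3); apply: (main k1 k2 k4 k3) => //; rewrite (mulnC a4).
    - by rewrite (addnC a1); apply: (main k2 k1 k3 k4) => //; rewrite (mulnC a2).
    - rewrite (addnC a1) (addnC a3).
      by apply: (main k2 k1 k4 k3) => //; rewrite (mulnC a2) (mulnC a4).
  exact: key.
have : (b n + G)%:R <= (b (n + t)%N)%:R :> R by rewrite ler_nat.
rewrite natrD -lerBrDl; apply: le_trans.
have t3 : t%:R <= 3 * (t./2)%:R :> R.
  by rewrite -natrM ler_nat; lia.
have beta_ge0 : 0 <= alpha ^- 2 by rewrite invr_ge0 exprn_ge0 // ltW.
have -> : 24 ^- 2 * t%:R ^+ 2 * alpha ^- 4 = (24^-1 * t%:R * alpha ^- 2) ^+ 2.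
  by rewrite !exprMn -!exprVn -exprM.
rewrite /G natrX ler_sqr ?nnegrE ?mulr_ge0 // natrM.
have := ler_pM (ler0n R t) beta_ge0 t3 M_ge.
lra.
Qed.
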